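(* Let $G$ be an embedded graph, let $H$ be an embedded graph with a distinguished non-loop edge $e$, let $G\otimes_{\varphi}H$ be their tensor product determined by the identifying maps $\varphi$, and let $\alpha,\beta,\gamma\in\mathbb{C}$. Then, for $t\in\mathbb{C}\setminus\{0,1,-2\}$, $$Q(G\otimes_{\varphi}H;(\alpha,\beta,\gamma),t)=Q(G;(\kappa,\lambda,\mu),t),$$ where $\kappa,\lambda,\mu$ are the unique solutions to $$t\kappa+t^2\lambda+t\mu=Q(H-e;(\alpha,\beta,\gamma),t),$$ $$t^2\kappa+t\lambda+t\mu=Q(H/e;(\alpha,\beta,\gamma),t),$$ $$t\kappa+t\lambda+t^2\mu=Q(H^{\tau(e)}/e;(\alpha,\beta,\gamma),t).$$
   Context: An embedded graph is a graph (loops and multiple edges allowed, not necessarily connected) cellularly embedded in a closed, possibly non-orientable, surface. Equivalently, it is a ribbon graph: a surface with boundary written as a union of vertex discs and edge discs (ribbons), each edge disc meeting the vertex discs in exactly two disjoint arcs. Equivalently, it is given by an arrow presentation: a set of circles carrying disjoint labelled arrows, exactly two with each label. The ribbon graph described by an arrow presentation has a vertex disc bounded by each circle, and for each label $e$ an edge disc with oriented boundary, attached along the two $e$-labelled arrows so that the directions of the arrows agree with the orientation of the boundary of the edge disc. Operations: $H-e$ is the ribbon graph with the edge disc $e$ deleted. $H/e$ is obtained from an arrow presentation of $H$ as follows: if $a,b$ are the two $e$-labelled arrows, connect the tip of $a$ to the tail of $b$ by a line segment and the tip of $b$ to the tail of $a$ by another line segment, then delete $a$, $b$ and the arcs of circles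 on which they lie. $H^{\tau(e)}$ is obtained by reversing exactly one of the two $e$-labelled arrows (adding a half-twist to the edge $e$). Medial graph and transition polynomial: $G_m$ is the 4-regular graph embedded in the same surface as $G$ obtained by placing a vertex $v_e$ on each edge $e$ of $G$ and drawing the edges of $G_m$ by following the face boundaries of $G$; an isolated vertex of $G$ contributes a free loop (a closed curve with no vertex). The canonical checkerboard colouring of $G_m$ colours black the faces of $G_m$ containing a vertex of $G$ and colours white the remaining faces. At a vertex $v$ of $G_m$ let $h_1,h_2,h_3,h_4$ be the four incident half-edges in cyclic order, labelled so that the corners between $h_1,h_2$ and between $h_3,h_4$ are white and those between $h_2,h_3$ and between $h_4,h_1$ are black. A vertex state at $v$ is a pairing of these half-edges (with the paired half-edges joined and $v$ removed): the white smoothing is $\{h_1,h_2\},\{h_3,h_4\}$, the black smoothing is $\{h_2,h_3\},\{h_4,h_1\}$, the crossing is $\{h_1,h_3\},\{h_2,h_4\}$. A graph state $s\in\mathcal{S}(G_m)$ is a choice of vertex state at every vertex; it yields $c(s)$ closed curves (including free loops). For $\alpha,\beta,\gamma\in\mathbb{C}$, the topological transition polynomial is $Q(G;(\alpha,\beta,\gamma),t)=\sum_{s\in\mathcal{S}(G_m)}\omega(s)t^{c(s)}$, where $\omega(s)$ is the product over vertices of $G_m$ of $\alpha$ for each white smoothing, $\beta$ for each black smoothing, and $\gamma$ for each crossing in $s$. Tensor product: let $G,H$ be ribbon graphs and $e$ a distinguished non-loop edge of $H$. Let $\beta^1,\beta^2$ be the two arcs in which the edge disc $e$ meets the vertex discs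 of $H$, and for each $f\in E(G)$ let $\alpha_f^1,\alpha_f^2$ be the two arcs in which $f$ meets the vertex discs of $G$. A family of identifying maps $\varphi=\{\varphi_f\}_{f\in E(G)}$ consists of homeomorphisms $\varphi_f$ from the edge disc $f$ to the edge disc $e$ that carry $\{\alpha_f^1,\alpha_f^2\}$ to $\{\beta^1,\beta^2\}$ (each arc onto an arc). Then $G\otimes_{\varphi}H$ is the ribbon graph formed as follows: for each $f\in E(G)$ take a copy of $H$ and identify $f$ with the edge $e$ of that copy using $\varphi_f$; then, for each $f$, delete the identified edge except for the two arcs $\varphi_f(\alpha_f^i)$, $i=1,2$. Along each such arc a vertex disc of $G$ and a vertex disc of the copy of $H$ are thereby merged into a single vertex. *)

(* Defs.v *)
From HB Require Import structures.
From mathcomp Require Import all_boot all_fingroup all_algebra.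

Set Implicit Arguments.
Unset Strict Implicit.
Unset Printing Implicit Defensive.

Import GRing.Theory.
Local Open Scope ring_scope.

(** * Ribbon graphs as arrow presentations *)

(* The four corners of an edge disc, i.e. the four ends of the two arrows with
   a given label: in [(i, b)], [i] says which of the two arrows is meant and
   [b] whether the end is its tail ([false]) or its tip ([true]).  Following
   the oriented boundary of the edge disc one meets
     tail 0, tip 0, tail 1, tip 1, and back to tail 0,
   so the boundary consists alternately of the two arrows (the arcs attached
   to vertex discs) and of the two free sides of the ribbon. *)
Definition corner : finType := (bool * bool)%type.

Definition arrow_opp (c : corner) : corner := (c.1, ~~ c.2).
Definition side_opp (c : corner) : corner := (~~ c.1, ~~ c.2).

Lemma arrow_oppK : involutive arrow_opp.
Proof. by case=> [] [] []. Qed.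

Lemma side_oppK : involutive side_opp.
Proof. by case=> [] [] []. Qed.

Lemma side_opp_neq c : side_opp c != c.
Proof. by case: c => [] [] []. Qed.

(* The circles are cut by finitely many points into pieces that are alternately
   "gaps" and "segments": [gap p] and [seg p] are the other ends of the gap and
   of the segment ending at [p].  The circles are thus the orbits of [gap] and
   [seg].  Every arrow occupies one segment; a segment may also carry no arrow,
   and a circle all of whose segments carry no arrow is an isolated vertex. *)
Record arrow_pres := ArrowPres {
  pt : finType;
  label : finType;
  gap : pt -> pt;
  seg : pt -> pt;
  arrow_end : label * corner -> pt;
  gapK : involutive gap;
  gap_neq : forall p, gap p != p;
  segK : involutive seg;
  seg_neq : forall p, seg p != p;
  arrow_end_inj : injective arrow_end;
  seg_arrow_end : forall f c,
    seg (arrow_end (f, c)) = arrow_end (f, arrow_opp c)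
}.

Definition same_circle (G : arrow_pres) : rel (pt G) :=
  connect (fun p q => (q == gap p) || (q == seg p)).

Definition non_loop (G : arrow_pres) (e : label G) : bool :=
  ~~ same_circle (arrow_end (e, (false, false))) (arrow_end (e, (true, false))).

(** * Deletion, partial twist, contraction *)

Section Operations.
Variables (H : arrow_pres) (e : label H).

Definition other_label : finType := {f : label H | f != e}.

Definition delete_end (x : other_label * corner) : pt H :=
  arrow_end (val x.1, x.2).

Lemma delete_end_inj : injective delete_end.
Proof. by move=> [f c] [g d] /arrow_end_inj[/val_inj -> ->]. Qed.

Lemma seg_delete_end f c :
  seg (delete_end (f, c)) = delete_end (f, arrow_opp c).
Proof. exact: seg_arrow_end. Qed.

Definition delete : arrow_pres :=
  ArrowPres (@gapK H) (@gap_neq H) (@segK H) (@seg_neq H)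
    delete_end_inj seg_delete_end.

(* The reversed arrow is the one with index [true]; reversing the other one
   gives the same ribbon graph. *)
Definition twist_corner (f : label H) (c : corner) : corner :=
  if (f == e) && c.1 then arrow_opp c else c.

Definition twist_end (x : label H * corner) : pt H :=
  arrow_end (x.1, twist_corner x.1 x.2).

Lemma twist_end_inj : injective twist_end.
Proof.
move=> [f c] [g d] /arrow_end_inj[/= <-]; rewrite /twist_corner.
by case: (f == e); case: c d => [] [] [] [[] []].
Qed.

Lemma seg_twist_end f c : seg (twist_end (f, c)) = twist_end (f, arrow_opp c).
Proof.
by rewrite /twist_end seg_arrow_end /twist_corner; case: c (f == e) => [[] []] [].
Qed.

Definition twist : arrow_pres :=
  ArrowPres (@gapK H) (@gap_neq H) (@segK H) (@seg_neq H)
    twist_end_inj seg_twist_end.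

(* The two segments carrying the [e]-arrows are replaced by segments without
   arrow, from the tip of each arrow to the tail of the other. *)
Definition contract_seg (p : pt H) : pt H :=
  if [pick c | arrow_end (e, c) == p] is Some c
  then arrow_end (e, side_opp c) else seg p.

Lemma contract_seg_end c :
  contract_seg (arrow_end (e, c)) = arrow_end (e, side_opp c).
Proof.
rewrite /contract_seg; case: pickP => [d /eqP/arrow_end_inj[->] //|/(_ c)].
by rewrite eqxx.
Qed.

Lemma contract_seg_out p :
  (forall c, arrow_end (e, c) != p) -> contract_seg p = seg p.
Proof.
by move=> np; rewrite /contract_seg; case: pickP => // c; rewrite (negPf (np c)).
Qed.

Variant end_spec (p : pt H) : Prop :=
  | IsEnd c of p = arrow_end (e, c)
  | NotEnd of (forall c, arrow_end (e, c) != p).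

Lemma endP p : end_spec p.
Proof.
case: (pickP (fun c => arrow_end (e, c) == p)) => [c /eqP <-|np].
  exact: (IsEnd (c := c)).
by apply: NotEnd => c; rewrite np.
Qed.

Lemma seg_out p :
  (forall c, arrow_end (e, c) != p) -> forall c, arrow_end (e, c) != seg p.
Proof.
move=> np c; apply: contraNneq (np (arrow_opp c)) => eq_p.
by rewrite -seg_arrow_end eq_p segK.
Qed.

Lemma contract_segK : involutive contract_seg.
Proof.
move=> p; case: (endP p) => [c ->|np].
  by rewrite !contract_seg_end side_oppK.
rewrite (contract_seg_out np) contract_seg_out ?segK //; exact: seg_out.
Qed.

Lemma contract_seg_neq p : contract_seg p != p.
Proof.
case: (endP p) => [c ->|np]; last by rewrite contract_seg_out ?seg_neq.
rewrite contract_seg_end; apply/eqP => /arrow_end_inj[] /eqP.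
by rewrite (negPf (side_opp_neq c)).
Qed.

Lemma contract_seg_delete_end f c :
  contract_seg (delete_end (f, c)) = delete_end (f, arrow_opp c).
Proof.
rewrite contract_seg_out ?seg_delete_end // => d.
by apply/eqP => /arrow_end_inj[ef _]; case: f ef => f /= /eqP ne /esym.
Qed.

Definition contract : arrow_pres :=
  ArrowPres (@gapK H) (@gap_neq H) contract_segK contract_seg_neq
    delete_end_inj contract_seg_delete_end.

End Operations.

(** * Medial graph and topological transition polynomial *)

(* A graph with 4-valent vertices and free loops, its edges and free loops being
   subdivided by points; each edge of this subdivision either links two points
   ([mlink], and [mthru] at the points that are not next to a vertex) or is a
   half-edge from a vertex [v] to a point [mhalf v k].  The index [k], taken
   modulo 4, runs through the half-edges in cyclic order around [v], and
   [mwhite v k] is the colour of the corner between [mhalf v k] and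
   [mhalf v (k + 1)]. *)
Record coloured_four_regular := ColouredFourRegular {
  mvertex : finType;
  mpt : finType;
  mlink : mpt -> mpt;
  mthru : mpt -> mpt;
  mhalf : mvertex -> 'I_4 -> mpt;
  mwhite : mvertex -> 'I_4 -> bool
}.

(* Corners of an edge disc in cyclic order, starting with a free side. *)
Definition ribbon_corner (k : 'I_4) : corner :=
  nth (false, false)
    [:: (false, true); (true, false); (true, true); (false, false)] k.

(* Around [v_e] the half-edges of the medial graph leave through the corners of
   the ribbon [e] and then follow the boundary of the vertex discs up to the
   next ribbon.  Two consecutive ones enclose either an arc attached to a vertex
   disc, hence a face containing a vertex of [G] (black), or a free side of the
   ribbon, hence a face coming from a face of [G] (white). *)
Definition medial (G : arrow_pres) : coloured_four_regular :=
  @ColouredFourRegular (label G) (pt G) (@gap G) (@seg G)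
    (fun e k => arrow_end (e, ribbon_corner k))
    (fun _ k => (ribbon_corner k).1 != (ribbon_corner (k + 1)).1).

Inductive vertex_state := WhiteSmoothing | BlackSmoothing | Crossing.

Definition vertex_state_code (x : vertex_state) : option bool :=
  match x with
  | WhiteSmoothing => Some true
  | BlackSmoothing => Some false
  | Crossing => None
  end.

Definition vertex_state_decode (x : option bool) : vertex_state :=
  match x with
  | Some true => WhiteSmoothing
  | Some false => BlackSmoothing
  | None => Crossing
  end.

Lemma vertex_state_codeK : cancel vertex_state_code vertex_state_decode.
Proof. by case. Qed.

HB.instance Definition _ :=
  Finite.copy vertex_state (can_type vertex_state_codeK).

Section States.
Variable M : coloured_four_regular.

Definition graph_state := {ffun mvertex M -> vertex_state}.

(* Index of the half-edge paired with the [k]-th half-edge at [v]. *)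
Definition partner (x : vertex_state) (v : mvertex M) (k : 'I_4) : 'I_4 :=
  match x with
  | WhiteSmoothing => if mwhite v k then k + 1 else k - 1
  | BlackSmoothing => if mwhite v k then k - 1 else k + 1
  | Crossing => k + 2
  end.

Definition state_adj (s : graph_state) : rel (mpt M) := fun p q =>
  [|| q == mlink p,
      [exists v, exists k, (p == mhalf v k) && (q == mhalf v (partner (s v) v k))]
    | [forall v, forall k, p != mhalf v k] && (q == mthru p)].

Definition curve_count (s : graph_state) : nat := n_comp (state_adj s) predT.

End States.

Section TransitionPolynomial.
Variable C : comNzRingType.

Definition state_weight (w : C * C * C) (x : vertex_state) : C :=
  match x with
  | WhiteSmoothing => w.1.1
  | BlackSmoothing => w.1.2
  | Crossing => w.2
  end.

Definition transition_poly (G : arrow_pres) (w : C * C * C) (t : C) : C :=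
  \sum_(s : graph_state (medial G))
    (\prod_(v : mvertex (medial G)) state_weight w (s v)) * t ^+ curve_count s.

End TransitionPolynomial.

(** * Tensor product *)

(* A homeomorphism between edge discs carrying attaching arcs to attaching arcs,
   up to isotopy through such homeomorphisms, is a bijection between the corners
   respecting the arcs and the free sides of the ribbons. *)
Record identifying_map := IdentifyingMap {
  corner_map : {perm corner};
  corner_map_arrow : {morph corner_map : c / arrow_opp c};
  corner_map_side : {morph corner_map : c / side_opp c}
}.

Section Tensor.
Variables (G H : arrow_pres) (e : label H) (phi : label G -> identifying_map).

Definition tensor_pt : finType := (pt G + label G * pt H)%type.
Definition tensor_label : finType := (label G * other_label e)%type.

Definition tensor_gap (p : tensor_pt) : tensor_pt :=
  match p with
  | inl p => inl (gap p)
  | inr (f, q) => inr (f, gap q)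
  end.

(* The circle of [G] carrying an [f]-arrow and the circle of the [f]-th copy of
   [H] carrying the [e]-arrow identified with it are both opened along these
   arrows and joined at their ends, as prescribed by [phi f]. *)
Definition tensor_seg (p : tensor_pt) : tensor_pt :=
  match p with
  | inl p =>
      if [pick x | arrow_end x == p] is Some (f, c)
      then inr (f, arrow_end (e, corner_map (phi f) c)) else inl (seg p)
  | inr (f, q) =>
      if [pick c | arrow_end (e, c) == q] is Some c
      then inl (arrow_end (f, (corner_map (phi f))^-1%g c)) else inr (f, seg q)
  end.

Definition tensor_end (x : tensor_label * corner) : tensor_pt :=
  inr (x.1.1, arrow_end (val x.1.2, x.2)).

Lemma tensor_gapK : involutive tensor_gap.
Proof. by case=> [p|[f q]] /=; rewrite gapK. Qed.

Lemma tensor_gap_neq p : tensor_gap p != p.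
Proof.
case: p => [p|[f q]]; apply/eqP => -[] /eqP; exact/negP/gap_neq.
Qed.

Lemma tensor_segl f c :
  tensor_seg (inl (arrow_end (f, c)))
  = inr (f, arrow_end (e, corner_map (phi f) c)).
Proof.
rewrite /=; case: pickP => [[g d] /eqP/arrow_end_inj[-> ->] //|/(_ (f, c))].
by rewrite eqxx.
Qed.

Lemma tensor_segr f c :
  tensor_seg (inr (f, arrow_end (e, c)))
  = inl (arrow_end (f, (corner_map (phi f))^-1%g c)).
Proof.
by rewrite /=; case: pickP => [d /eqP/arrow_end_inj[->] //|/(_ c)]; rewrite eqxx.
Qed.

Lemma tensor_seg_outl p :
  (forall x, arrow_end x != p) -> tensor_seg (inl p) = inl (seg p).
Proof.
by move=> np; rewrite /=; case: pickP => // x; rewrite (negPf (np x)).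
Qed.

Lemma tensor_seg_outr f q :
  (forall c, arrow_end (e, c) != q) -> tensor_seg (inr (f, q)) = inr (f, seg q).
Proof.
by move=> np; rewrite /=; case: pickP => // c; rewrite (negPf (np c)).
Qed.

Lemma tensor_segK : involutive tensor_seg.
Proof.
case=> [p|[f q]].
  case: (pickP (fun x => arrow_end x == p)) => [[f c] /eqP <-|np].
    by rewrite tensor_segl tensor_segr permK.
  have np' x : arrow_end x != p by rewrite np.
  rewrite (tensor_seg_outl np') tensor_seg_outl ?segK // => -[f c].
  exact: (seg_out (fun d => np' (f, d))).
case: (endP e q) => [c ->|nq]; first by rewrite tensor_segr tensor_segl permKV.
rewrite (tensor_seg_outr f nq) tensor_seg_outr ?segK //; exact: seg_out.
Qed.

Lemma tensor_seg_neq p : tensor_seg p != p.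
Proof.
case: p => [p|[f q]].
  case: (pickP (fun x => arrow_end x == p)) => [[f c] /eqP <-|np].
    by rewrite tensor_segl.
  rewrite tensor_seg_outl => [|x]; last by rewrite np.
  by apply/eqP => -[] /eqP; apply/negP/seg_neq.
case: (endP e q) => [c ->|nq]; first by rewrite tensor_segr.
by rewrite tensor_seg_outr //; apply/eqP => -[] /eqP; apply/negP/seg_neq.
Qed.

Lemma tensor_end_inj : injective tensor_end.
Proof.
by move=> [[f h] c] [[g k] d] [/= ->] /arrow_end_inj[/val_inj -> ->].
Qed.

Lemma tensor_seg_end h c :
  tensor_seg (tensor_end (h, c)) = tensor_end (h, arrow_opp c).
Proof.
rewrite /tensor_end tensor_seg_outr ?seg_arrow_end //= => d.
by apply/eqP => /arrow_end_inj[eh _]; case: h.2 eh => k /= /eqP ne /esym.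
Qed.

Definition tensor : arrow_pres :=
  ArrowPres tensor_gapK tensor_gap_neq tensor_segK tensor_seg_neq
    tensor_end_inj tensor_seg_end.

End Tensor.

(* Main.v *)
Require Import Defs.
From mathcomp Require Import all_boot all_order all_algebra.
From mathcomp Require Import perm ring reals.
From mathcomp Require Import complex.

(* Fix a choice of vertex states in H away from e.  The curves it draws in H,
   cut open at the four corners of e, are closed curves together with two arcs,
   whose ends pair up the corners.  There are three pairings of four corners,
   and they correspond to the three vertex states; so the outside of e behaves
   like one vertex in the "outer state" given by the arcs.  Let [k x] be the
   weighted sum, with t to the number of closed curves, of the choices with
   outer state x.

   Deletion, contraction and twisted contraction close the two arcs by a black
   smoothing, a white smoothing and a crossing; they yield two curves if the
   outer state is the same as the closing one, and one curve otherwise.  This is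
   the linear system for (kappa, lambda, mu) = (k white, k black, k crossing).

   In the tensor product the arcs of the f-th copy of H are plugged into the
   corners of f; since identifying maps preserve the three pairings, the curves
   there are those of G with f in the outer state, plus the closed curves of the
   copies.  Summing over each copy replaces its weights by k. *)

Set Implicit Arguments.
Unset Strict Implicit.
Unset Printing Implicit Defensive.

Import GRing.Theory Num.Theory.
Local Open Scope ring_scope.

(** * Orbits generated by two involutions *)

Section Alternating.
Variables (T : finType) (g m : T -> T).
Hypotheses (gK : involutive g) (mK : involutive m).

Definition alternating : rel T := fun p q => (q == g p) || (q == m p).

Lemma alternating_sym : symmetric alternating.
Proof. by move=> p q; rewrite /alternating !(eq_sym q) !inv_eq. Qed.

Lemma alternating_connect_sym : connect_sym alternating.
Proof. exact/sym_connect_sym/alternating_sym. Qed.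

Lemma alternating_closed (a : {pred T}) :
  (forall p, p \in a -> g p \in a) -> (forall p, p \in a -> m p \in a) ->
  closed alternating a.
Proof.
move=> ga ma; apply: intro_closed; first exact: alternating_connect_sym.
by move=> p q /orP[] /eqP ->; [apply: ga|apply: ma].
Qed.

(* With f = m g, reflections act on the f-orbit of x by
   m (f^k x) = f^(-k) x and g (f^k x) = f^(-k-1) x.  As g has no fixed point
   the length N of the orbit is even, and m fixes only x and f^(N/2) x. *)
Lemma alternating_path x :
  (forall p, g p != p) -> m x = x ->
  exists y, [/\ y != x, m y = y, connect alternating x y &
    forall z, m z = z -> connect alternating x z -> z = x \/ z = y].
Proof.
move=> g_neq mx; pose f p := m (g p); pose N := order f x.
have f_inj : injective f by move=> p q /(inv_inj mK)/(inv_inj gK).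
have mf k : (k <= N)%N -> m (iter k f x) = iter (N - k) f x.
  elim: k => [|k IHk] lt_kN; first by rewrite subn0 iter_order.
  apply: f_inj; rewrite -iterS -subSn // subSS -IHk 1?ltnW //.
  by rewrite iterS /f mK gK.
have gf k : (k < N)%N -> g (iter k f x) = iter (N - k.+1) f x.
  by move=> lt_kN; rewrite -(mf _ lt_kN) iterS /f mK.
have conn k : connect alternating x (iter k f x).
  elim: k => //= k IHk; apply: connect_trans IHk _.
  apply: (@connect_trans _ _ (g (iter k f x))).
    by apply: connect1; rewrite /alternating eqxx.
  by apply: connect1; rewrite /alternating eqxx orbT.
have reach z : connect alternating x z -> exists2 k, (k < N)%N & z = iter k f x.
  have cl : closed alternating [pred p | fconnect f x p].
    apply: alternating_closed => p; rewrite !inE => fp;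
      rewrite -(iter_findex fp) ?gf ?mf ?fconnect_iter ?findex_max //.
    by rewrite ltnW ?findex_max.
  move/(closed_connect cl); rewrite !inE connect0 => /esym fz.
  by exists (findex f x z); rewrite ?findex_max ?iter_findex.
have N_gt0 : (0 < N)%N by apply: order_gt0.
have evenN : ~~ odd N.
  apply/negP => oddN; have := g_neq (iter N./2 f x).
  have defN : N = (N./2 + N./2).+1 by rewrite addnn -[LHS]odd_double_half oddN.
  have -> := gf N./2; last by rewrite [ltnRHS]defN ltnS leq_addr.
  by rewrite [X in (X - _)%N]defN subSS addKn eqxx.
have defN : N = (N./2 + N./2)%N.
  by rewrite addnn -[LHS]odd_double_half (negPf evenN).
have half_gt0 : (0 < N./2)%N by case: N./2 defN N_gt0 => // ->.
have lt_half : (N./2 < N)%N by rewrite {2}defN -addn1 leq_add2l.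
have inj k l : (k < N)%N -> (l < N)%N -> iter k f x = iter l f x -> k = l.
  by move=> lt_k lt_l eq_kl; rewrite -(findex_iter lt_k) eq_kl findex_iter.
exists (iter N./2 f x); split; last 1 first.
- move=> z mz /reach[[|k] lt_kN defz]; [by left|right; rewrite defz].
  have /inj eq_k : iter (N - k.+1) f x = iter k.+1 f x 
    by rewrite -mf ?(ltnW lt_kN) -?defz.
  have -> : N = (k.+1).*2.
    by rewrite -addnn -{1}eq_k ?subnK ?(ltnW lt_kN) ?ltn_subrL ?N_gt0.
  by rewrite doubleK.
- by apply/eqP => /(@inj _ 0%N lt_half N_gt0) half0; rewrite half0 in half_gt0.
- by rewrite mf ?(ltnW lt_half) // [X in (X - _)%N]defN addnK.
- exact: conn.
Qed.

End Alternating.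

(** * Pairings of the four corners of a ribbon *)

(** The three fixed-point-free involutions that pair corners: along a free side (white), along an
    arrow (black), and diagonally across the edge disc (crossing). *)
Definition state_pairing (x : vertex_state) (c : corner) : corner :=
  match x with
  | WhiteSmoothing => side_opp c
  | BlackSmoothing => arrow_opp c
  | Crossing => (~~ c.1, c.2)
  end.

Lemma state_pairingK x : involutive (state_pairing x).
Proof. by case: x => [] [[] []]. Qed.

Lemma state_pairing_neq x c : state_pairing x c != c.
Proof. by case: x c => [] [[] []]. Qed.

(** The crossing is the composite of [arrow_opp] and [side_opp], so commuting with these two is
    enough. *)
Lemma corner_map_state_pairing (f : identifying_map) x c :
  corner_map f (state_pairing x c) = state_pairing x (corner_map f c).
Proof.
case: f => f f_arrow f_side /=; case: x => //=.
have -> : (~~ c.1, c.2) = arrow_opp (side_opp c) by case: c => [] [] [].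
by rewrite f_arrow f_side; case: (f c) => [] [] [].
Qed.

(** Symmetry makes the partner map an involution without fixed points, and four corners admit only
    three of those. *)
Lemma corner_matching (r : rel corner) : symmetric r ->
  (forall c, exists2 d, d != c & forall c', r c c' = (c' == c) || (c' == d)) ->
  exists x, forall c d, r c d = (d == c) || (d == state_pairing x c).
Proof.
move=> r_sym r_pair.
have [d0 nd0 r0] := r_pair (false, false).
have [d1 nd1 r1] := r_pair (false, true).
have [d2 nd2 r2] := r_pair (true, false).
have [d3 nd3 r3] := r_pair (true, true).
have := (r_sym (false, false) (false, true), r_sym (false, false) (true, false),
  r_sym (false, false) (true, true), r_sym (false, true) (true, false),
  r_sym (false, true) (true, true), r_sym (true, false) (true, true)).
rewrite !r0 !r1 !r2 !r3 => -[[[[[]]]]].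
case: d0 nd0 r0 => [[] []] //= _ r0; case: d1 nd1 r1 => [[] []] //= _ r1 //= _;
  case: d2 nd2 r2 => [[] []] //= _ r2 //= _;
  case: d3 nd3 r3 => [[] []] //= _ r3 //= _ _ _ _;
  [exists WhiteSmoothing | exists Crossing | exists BlackSmoothing];
  by case=> [[] []] d; rewrite ?(r0, r1, r2, r3).
Qed.

(** * Curves of a state as orbits of two involutions *)

Section Glue.
Variables (G : arrow_pres).
Implicit Types (P : label G -> corner -> corner) (p q : pt G).

Variant arrow_spec p : Prop :=
  | ArrowEnd f c of p = arrow_end (f, c)
  | NoArrow of (forall x, arrow_end x != p).

Lemma arrowP p : arrow_spec p.
Proof.
case: (pickP (fun x => arrow_end x == p)) => [[f c] /eqP <-|np].
  exact: (ArrowEnd (f := f) (c := c)).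
by apply: NoArrow => x; rewrite np.
Qed.

(** One step of a curve through a ribbon or along a plain segment. [P] is not restricted to vertex
    states: the identity at a label cuts the curves open there. *)
Definition glue P p : pt G :=
  if [pick x | arrow_end x == p] is Some x
  then arrow_end (x.1, P x.1 x.2) else seg p.

Lemma glue_end P f c : glue P (arrow_end (f, c)) = arrow_end (f, P f c).
Proof.
rewrite /glue; case: pickP => [x /eqP/arrow_end_inj -> //|/(_ (f, c))].
by rewrite eqxx.
Qed.

Lemma glue_out P p : (forall x, arrow_end x != p) -> glue P p = seg p.
Proof.
by move=> np; rewrite /glue; case: pickP => // x; rewrite (negPf (np x)).
Qed.

Lemma seg_no_arrow p :
  (forall x, arrow_end x != p) -> forall x, arrow_end x != seg p.
Proof. by move=> np [f c]; apply: seg_out => d; apply: np. Qed.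

Lemma glueK P : (forall f, involutive (P f)) -> involutive (glue P).
Proof.
move=> PK p; have [f c ->|np] := arrowP p; first by rewrite !glue_end PK.
by rewrite (glue_out P np) glue_out ?segK //; apply: seg_no_arrow.
Qed.

Definition curves P : rel (pt G) := alternating (@gap G) (glue P).

Lemma curves_connect_sym P :
  (forall f, involutive (P f)) -> connect_sym (curves P).
Proof. by move=> PK; apply/alternating_connect_sym/glueK/PK; apply: gapK. Qed.

Lemma curves_gap P p : curves P p (gap p).
Proof. by rewrite /curves /alternating eqxx. Qed.

Lemma curves_glue P p : curves P p (glue P p).
Proof. by rewrite /curves /alternating eqxx orbT. Qed.

(** Turns the index arithmetic modulo 4 around a medial vertex into involutions of corners; all
    states and indices are checked by computation. *)
Lemma ribbon_corner_partner (s : graph_state (medial G)) f (k : 'I_4) :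
  ribbon_corner (partner (s f) f k) = state_pairing (s f) (ribbon_corner k).
Proof. by case: (s f); case: k => [[|[|[|[|]]]] lt_k]. Qed.

Lemma ribbon_corner_onto c : exists k, ribbon_corner k = c.
Proof.
case: c => [[] []].
- by exists (inord 2); rewrite /ribbon_corner inordK.
- by exists (inord 1); rewrite /ribbon_corner inordK.
- by exists (inord 0); rewrite /ribbon_corner inordK.
- by exists (inord 3); rewrite /ribbon_corner inordK.
Qed.

Lemma state_adjE (s : graph_state (medial G)) :
  state_adj s =2 curves (fun f => state_pairing (s f)).
Proof.
move=> p q; rewrite /state_adj /curves /alternating; congr (_ || _).
have [f c ->|np] := arrowP p.
  rewrite glue_end; have [k defc] := ribbon_corner_onto c.
  apply/orP/eqP => [[/existsP[g /existsP[l /andP[/eqP]]]|/andP[]]|->].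
  - by move=> /arrow_end_inj[<- ->] /eqP->; rewrite /= ribbon_corner_partner.
  - by move/forallP/(_ f)/forallP/(_ k); rewrite /= defc eqxx.
  left; apply/existsP; exists f; apply/existsP; exists k.
  by rewrite /= ribbon_corner_partner defc !eqxx.
rewrite glue_out //.
apply/orP/eqP => [[/existsP[g /existsP[l /andP[/eqP defp _]]]|/andP[_ /eqP]]|->] //.
  by have := np (g, ribbon_corner l); rewrite defp eqxx.
right; rewrite eqxx andbT.
by apply/forallP => g; apply/forallP => l; rewrite eq_sym np.
Qed.

Lemma curve_countE (s : graph_state (medial G)) :
  curve_count s = n_comp (curves (fun f => state_pairing (s f))) predT.
Proof. exact/eq_n_comp/eq_connect/state_adjE. Qed.

End Glue.
Lemma eq_glue (G : arrow_pres) (P P' : label G -> corner -> corner) :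
  (forall f, P f =1 P' f) -> glue P =1 glue P'.
Proof.
move=> eqP p; have [f c ->|np] := arrowP p; first by rewrite !glue_end eqP.
by rewrite !glue_out.
Qed.

(** Used to recognise closed curves that stay away from e: the relations agree there, so [h] is a
    strict adjunction. *)
Lemma n_comp_closed_inj (T U : finType) (h : U -> T) (r : rel T) (r' : rel U)
    (a : {pred T}) :
  connect_sym r -> connect_sym r' -> closed r a -> injective h ->
  a \subset codom h -> (forall u v, h u \in a -> r (h u) (h v) = r' u v) ->
  n_comp r a = n_comp r' [preim h of a].
Proof.
move=> r_sym r'_sym cl_a h_inj sub_a eq_r.
apply: adjunction_n_comp => //; apply: strict_adjunction => // u v.
by rewrite negbK => /eq_r.
Qed.

(** * States outside a distinguished edge *)

Section OpenState.
Variables (H : arrow_pres) (e : label H).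
Implicit Types (s : {ffun other_label e -> vertex_state}) (q : pt H).

(** The gluing at [e] is left free: [id] opens the curves there, a [state_pairing] closes them. *)
Definition extend_state s (P : corner -> corner) (f : label H) :
    corner -> corner :=
  if insub f is Some h then state_pairing (s h) else P.

Lemma extend_state_distinguished s P : extend_state s P e = P.
Proof. by rewrite /extend_state insubF ?eqxx. Qed.

Lemma extend_state_other s P (h : other_label e) :
  extend_state s P (val h) = state_pairing (s h).
Proof. by rewrite /extend_state valK. Qed.

Lemma extend_stateK s P :
  involutive P -> forall f, involutive (extend_state s P f).
Proof.
move=> PK f; rewrite /extend_state; case: insub => // h.
exact: state_pairingK.
Qed.

Definition open_curves s : rel (pt H) := curves (extend_state s id).

Lemma open_curves_sym s : connect_sym (open_curves s).
Proof. exact/curves_connect_sym/extend_stateK. Qed.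

Lemma glue_extend_out s P q : (forall c, arrow_end (e, c) != q) ->
  glue (extend_state s P) q = glue (extend_state s id) q.
Proof.
move=> nq; have [f c defq|nq'] := arrowP q; last by rewrite !glue_out.
rewrite defq !glue_end /extend_state; case: insubP => // /negPn/eqP def_f.
by have := nq c; rewrite defq def_f eqxx.
Qed.

Lemma glue_extend_end s P c :
  glue (extend_state s P) (arrow_end (e, c)) = arrow_end (e, P c).
Proof. by rewrite glue_end extend_state_distinguished. Qed.

(** Segments and vertex states move every point, so an open curve can end only at a corner of
    [e]. *)
Lemma glue_open_fixed s q :
  glue (extend_state s id) q = q -> exists c, q = arrow_end (e, c).
Proof.
have [f c ->|nq] := arrowP q; last first.
  by rewrite glue_out // => /eqP; rewrite (negPf (seg_neq q)).
rewrite glue_end /extend_state; case: insubP => [h _ _|/negPn/eqP-> _].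
  by move=> /arrow_end_inj[] /eqP; rewrite (negPf (state_pairing_neq _ _)).
by exists c.
Qed.

(** A corner of [e] is fixed by the gluing, so by [alternating_path] its arc has exactly one other
    end, which is again a corner of [e]. *)
Lemma open_curves_matching s : exists x, forall c d,
  connect (open_curves s) (arrow_end (e, c)) (arrow_end (e, d))
  = (d == c) || (d == state_pairing x c).
Proof.
apply: (corner_matching (r := fun c d => connect (open_curves s)
          (arrow_end (e, c)) (arrow_end (e, d)))) => [c d|c].
  exact: open_curves_sym.
have glueKid := glueK (extend_stateK s (P := id) (fun _ => erefl)).
have [q [neq_q glue_q conn_q path_q]] := alternating_path (@gapK H) glueKid
  (x := arrow_end (e, c)) (@gap_neq H) (glue_extend_end s id c).
have [d def_q] := glue_open_fixed glue_q; exists d.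
  by apply: contraNneq neq_q => <-; rewrite def_q.
move=> c'; apply/idP/orP => [conn_c'|[]/eqP->].
- have [/arrow_end_inj[->]|] := path_q _ (glue_extend_end s id c') conn_c'.
    by left.
  by rewrite def_q => /arrow_end_inj[->]; right.
- exact: connect0.
- by rewrite -def_q.
Qed.

(* The [pick] never fails, by [open_curves_matching]. *)
Definition outer_state s : vertex_state :=
  odflt WhiteSmoothing
    [pick x | [forall c, forall d,
      connect (open_curves s) (arrow_end (e, c)) (arrow_end (e, d))
      == (d == c) || (d == state_pairing x c)]].

Lemma open_curvesE s c d :
  connect (open_curves s) (arrow_end (e, c)) (arrow_end (e, d))
  = (d == c) || (d == state_pairing (outer_state s) c).
Proof.
rewrite /outer_state; case: pickP => [x /forallP/(_ c)/forallP/(_ d)/eqP //|].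
have [x Px] := open_curves_matching s; move/(_ x)/forallP => -[] c'.
by apply/forallP => d'; rewrite Px.
Qed.

Definition meets_edge s : {pred pt H} :=
  [pred q | [exists c, connect (open_curves s) (arrow_end (e, c)) q]].

Definition closed_curves s : nat :=
  n_comp (open_curves s) [predC meets_edge s].

Lemma meets_edge_end s c : arrow_end (e, c) \in meets_edge s.
Proof. by apply/existsP; exists c; apply: connect0. Qed.

Lemma closed_meets_edge s : closed (open_curves s) (meets_edge s).
Proof.
apply: intro_closed => [|p q pq]; first exact: open_curves_sym.
rewrite !inE => /existsP[c cp]; apply/existsP; exists c.
exact/(connect_trans cp)/connect1.
Qed.

(** At the corners of [e] the open gluing only links a point to itself, so replacing it loses no
    connection. *)
Lemma connect_open_curves s P :
  subrel (connect (open_curves s)) (connect (curves (extend_state s P))).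
Proof.
apply: connect_sub => p q /orP[/eqP->|/eqP->].
  exact/connect1/curves_gap.
have [c ->|np] := endP e p; first by rewrite glue_extend_end connect0.
by rewrite -(glue_extend_out s P np); apply/connect1/curves_glue.
Qed.

(** Closed curves away from [e] persist. The two arcs close up separately if [x] joins the ends of
    each arc, and into a single curve otherwise. *)
Lemma curves_extend_count s x :
  n_comp (curves (extend_state s (state_pairing x))) predT
  = (closed_curves s + (outer_state s == x).+1)%N.
Proof.
set y := outer_state s; set r := curves _.
have r_sym : connect_sym r.
  exact/curves_connect_sym/extend_stateK/state_pairingK.
pose c0 : corner := (false, false).
pose z := if y is WhiteSmoothing then BlackSmoothing else WhiteSmoothing.
(* [c0] and [c1] lie in different pairs of the outer state [y]. *)
pose c1 := state_pairing z c0.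
have corners c :
    exists2 d, d \in [:: c0; c1] & (c == d) || (c == state_pairing y d).
  by apply/hasP; rewrite /c1 /z; case: c (y) => [[] []] [].
have r_end c : connect r (arrow_end (e, c)) (arrow_end (e, state_pairing x c)).
  by rewrite -(glue_extend_end s); apply/connect1/curves_glue.
have closed_r : closed r (meets_edge s).
  apply: intro_closed => // p q /orP[]/eqP->.
    by rewrite (closed_meets_edge (curves_gap _ p)).
  have [c ->|np] := endP e p; first by rewrite glue_extend_end !meets_edge_end.
  by rewrite glue_extend_out // (closed_meets_edge (curves_glue _ p)).
rewrite [LHS](n_compC (meets_edge s)) addnC; congr (_ + _)%N.
  apply: (n_comp_closed_inj (h := id)) => //.
  - exact: open_curves_sym.
  - by move=> p q /closed_r; rewrite !inE => ->.
  - by apply/subsetP => q _; apply/codomP; exists q.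
  move=> p q; rewrite !inE => np; rewrite /r /open_curves /curves /alternating.
  rewrite glue_extend_out // => c; apply: contraNneq np => <-.
  exact: meets_edge_end.
have corner_r d q : connect (open_curves s) (arrow_end (e, d)) q ->
  connect r (arrow_end (e, d)) q by exact: connect_open_curves.
have pair_r d : connect r (arrow_end (e, d)) (arrow_end (e, state_pairing y d)).
  by apply: corner_r; rewrite open_curvesE eqxx orbT.
(* [c0] and [c1] represent the two arcs, so what remains is whether [r] connects them. *)
rewrite (eq_n_comp_r
  (a' := closure r (pred2 (arrow_end (e, c0)) (arrow_end (e, c1))))); last first.
  move=> q; rewrite !inE; apply/existsP/pred0Pn => [[c cq]|[p /andP[]]].
    have [d d_in cd] := corners c; exists (arrow_end (e, d)).
    rewrite /= !inE; apply/andP; split; last first.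
      by move: d_in; rewrite !inE => /orP[]/eqP->; rewrite eqxx ?orbT.
    rewrite r_sym; apply: connect_trans (corner_r _ _ cq).
    by case/orP: cd => /eqP->.
  rewrite !inE => qd; rewrite /= => d_eq; apply/existsP.
  change (q \in meets_edge s); rewrite (closed_connect closed_r qd).
  by case/orP: d_eq => /eqP->; apply: meets_edge_end.
rewrite n_comp_closure2 //; congr (nat_of_bool _).+1.
case: eqP => [eq_yx|/eqP neq_yx].
  (* When [x] is the outer state, closing at [e] only joins corners already on the same arc. *)
  apply/negP => /(connect_sub (e' := open_curves s)) conn.
  have: connect (open_curves s) (arrow_end (e, c0)) (arrow_end (e, c1)).
    apply: conn => p q /orP[]/eqP->; first exact/connect1/curves_gap.
    have [c ->|np] := endP e p.
      by rewrite glue_extend_end open_curvesE -/y eq_yx eqxx orbT.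
    by rewrite glue_extend_out //; apply/connect1/curves_glue.
  by rewrite open_curvesE -/y /c1 /z; case: (y).
(* The composite of two distinct pairings is the third: if [x] is not [z], then [z] is [x] after
   [y]. *)
apply/negbF; have [->|c1E] :
    c1 = state_pairing x c0 \/ c1 = state_pairing x (state_pairing y c0).
- by rewrite /c1 /z; case: (y) (x) neq_yx => [] []; auto.
- exact: r_end.
by rewrite c1E; apply: connect_trans (r_end _).
Qed.

End OpenState.

(** * Deletion, contraction and twisted contraction as closings of the arcs *)

Section ReplaceEdge.
Variables (H : arrow_pres) (e : label H) (x : vertex_state).
Variables (seg' : pt H -> pt H) (end' : other_label e * corner -> pt H).
Hypotheses (segK' : involutive seg') (seg_neq' : forall p, seg' p != p).
Hypotheses (end_inj' : injective end').
Hypothesis seg_end' :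
  forall h c, seg' (end' (h, c)) = end' (h, arrow_opp c).
Hypothesis end'E : forall h c, end' (h, c) = arrow_end (val h, c).
Hypothesis seg'_edge :
  forall c, seg' (arrow_end (e, c)) = arrow_end (e, state_pairing x c).
Hypothesis seg'_out :
  forall p, (forall c, arrow_end (e, c) != p) -> seg' p = seg p.

Let H' : arrow_pres :=
  ArrowPres (@gapK H) (@gap_neq H) segK' seg_neq' end_inj' seg_end'.

(** The new segments at [e] carry no arrow, so every curve follows them exactly as it would follow
    the vertex state [x]. *)
Lemma replace_edge_count (s : graph_state (medial H')) :
  curve_count s = (closed_curves s + (outer_state s == x).+1)%N.
Proof.
rewrite curve_countE -curves_extend_count; apply/eq_n_comp/eq_connect => p q.
congr (_ || (q == _)).
have [h c ->|np] := @arrowP H' p.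
  by rewrite glue_end /= !end'E glue_end extend_state_other.
rewrite glue_out //=; have [c ->|np'] := endP e p.
  by rewrite glue_extend_end seg'_edge.
rewrite seg'_out // glue_out // => -[f c].
case: (eqVneq f e) => [->//|f_e].
by have := np (exist _ f f_e, c); rewrite /= end'E.
Qed.

Lemma replace_edge_poly (C : comNzRingType) (w : C * C * C) (t : C) :
  transition_poly H' w t = \sum_(s : {ffun other_label e -> vertex_state})
    (\prod_h state_weight w (s h))
    * t ^+ (closed_curves s + (outer_state s == x).+1).
Proof. by apply: eq_bigr => s _; rewrite replace_edge_count. Qed.

End ReplaceEdge.

Section Operations.
Variables (C : comNzRingType) (H : arrow_pres) (e : label H).
Variables (w : C * C * C) (t : C).

Definition outer_weight (x : vertex_state) : C :=
  \sum_(s : {ffun other_label e -> vertex_state} | outer_state s == x)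
    (\prod_h state_weight w (s h)) * t ^+ closed_curves s.

Lemma sum_outer_weight x :
  \sum_(s : {ffun other_label e -> vertex_state})
    (\prod_h state_weight w (s h))
    * t ^+ (closed_curves s + (outer_state s == x).+1)
  = \sum_y outer_weight y * t ^+ (y == x).+1.
Proof.
rewrite (partition_big (@outer_state H e) predT) //=; apply: eq_bigr => y _.
rewrite mulr_suml; apply: eq_bigr => s /eqP <-.
by rewrite exprD mulrA.
Qed.

(** Each [e]-arrow becomes a plain segment from its tail to its own tip: the black pairing. *)
Lemma transition_poly_delete :
  transition_poly (delete e) w t
  = \sum_y outer_weight y * t ^+ (y == BlackSmoothing).+1.
Proof.
rewrite -sum_outer_weight; apply: replace_edge_poly => // c.
exact: seg_arrow_end.
Qed.

(** The new segments run from tip to tail of the other arrow: the white pairing. *)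
Lemma transition_poly_contract :
  transition_poly (contract e) w t
  = \sum_y outer_weight y * t ^+ (y == WhiteSmoothing).+1.
Proof.
rewrite -sum_outer_weight; apply: replace_edge_poly => // [c|p np].
  exact: contract_seg_end.
exact: contract_seg_out.
Qed.

(** With one arrow reversed, the contraction segments join tail to tail and tip to tip: the
    crossing. *)
Lemma transition_poly_contract_twist :
  transition_poly (contract (H := twist e) e) w t
  = \sum_y outer_weight y * t ^+ (y == Crossing).+1.
Proof.
have untwist c :
    arrow_end (e, c) = arrow_end (a := twist e) (e, twist_corner e e c).
  by rewrite /= /twist_end /= /twist_corner eqxx; case: c => [[] []].
rewrite -sum_outer_weight.
apply: (@replace_edge_poly H e Crossing) => [h c|c|p np].
- by rewrite /delete_end /= /twist_end /twist_corner /= (negPf (valP h)).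
- rewrite untwist contract_seg_end /= /twist_end /twist_corner /= eqxx.
  by case: c => [[] []].
by apply: (@contract_seg_out (twist e)) => c; rewrite /= /twist_end /=; apply: np.
Qed.

End Operations.

(** The indicator identity says that the [A i] partition [a], so each root in [a] is counted
    once. *)
Lemma n_comp_sum (T I : finType) (r : rel T) (a : {pred T})
    (A : I -> {pred T}) :
  (forall x, nat_of_bool (x \in a) = \sum_i (x \in A i))%N ->
  n_comp r a = (\sum_i n_comp r (A i))%N.
Proof.
move=> aE; rewrite /n_comp_mem -sum1_card big_mkcond /=.
under [RHS]eq_bigr do rewrite -sum1_card big_mkcond /=.
rewrite exchange_big; apply: eq_bigr => x _ /=.
have indicator (c : {pred T}) :
    (if x \in predI (roots r) (mem c) then 1 else 0)%N
    = (roots r x && (x \in c)).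
  by rewrite inE; case: ifP.
rewrite indicator; under eq_bigr do rewrite indicator.
case: (roots r x) => /=; last by rewrite big1.
exact: aE.
Qed.

(** * Curves of a tensor product *)

Section Tensor.
Variables (G H : arrow_pres) (e : label H) (phi : label G -> identifying_map).
Variable S : label G -> {ffun other_label e -> vertex_state}.

Let P (x : label (tensor e phi)) : corner -> corner :=
  state_pairing (S x.1 x.2).
Let r : rel (pt (tensor e phi)) := curves P.
Let outer (f : label G) : corner -> corner := state_pairing (outer_state (S f)).

Let r_sym : connect_sym r.
Proof. by apply: curves_connect_sym => x; apply: state_pairingK. Qed.

Let glue_l f c : glue P (inl (arrow_end (f, c)))
  = inr (f, arrow_end (e, corner_map (phi f) c)).
Proof. by rewrite glue_out //; apply: tensor_segl. Qed.

Let glue_l_out p : (forall x, arrow_end x != p) ->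
  glue P (inl p) = inl (seg p) :> pt (tensor e phi).
Proof. by move=> np; rewrite glue_out //; apply: tensor_seg_outl. Qed.

Let glue_r f c : glue P (inr (f, arrow_end (e, c)))
  = inl (arrow_end (f, (corner_map (phi f))^-1%g c)).
Proof.
rewrite glue_out => [|[[g h] d]]; first exact: tensor_segr.
apply/eqP => -[_] /arrow_end_inj[eq_e _].
by case: h eq_e => /= h /eqP neq_h /neq_h.
Qed.

Let glue_r_out f q : (forall c, arrow_end (e, c) != q) ->
  glue P (inr (f, q)) = inr (f, glue (extend_state (S f) id) q).
Proof.
move=> nq; have [g c def_q|nq'] := arrowP q.
  have g_e : g != e by apply: contraNneq (nq c) => <-; rewrite def_q.
  have -> : inr (f, q) = arrow_end (a := tensor e phi) ((f, exist _ g g_e), c).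
    by rewrite def_q.
  rewrite glue_end def_q glue_end -[g]/(val (exist _ g g_e : other_label e)).
  by rewrite extend_state_other.
rewrite !glue_out // => [|[[g h] c]]; first exact: tensor_seg_outr.
by apply/eqP => -[_] eq_q; case/eqP: (nq' (val h, c)).
Qed.

Let connect_r f q q' : connect (open_curves (S f)) q q' ->
  connect r (inr (f, q)) (inr (f, q')).
Proof.
have cl : closed (open_curves (S f))
    [pred p | connect r (inr (f, q)) (inr (f, p))].
  apply: intro_closed => [|p p' /orP[]/eqP->]; first exact: open_curves_sym.
    rewrite !inE => qp; apply: connect_trans qp (connect1 _).
    exact: (curves_gap P (inr (f, p))).
  rewrite !inE => qp; have [c def_p|np] := endP e p.
    by rewrite def_p glue_extend_end -def_p.
  apply: connect_trans qp (connect1 _).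
  by rewrite -glue_r_out //; apply: curves_glue.
by move/(closed_connect cl); rewrite !inE connect0.
Qed.

(** A jump across f in G is realised by entering the f-th copy, following an open arc and returning;
    the arc ends correctly since [phi f] preserves pairings. *)
Let connect_outer p q :
  connect (curves outer) p q = connect r (inl p) (inl q).
Proof.
apply/idP/idP => [|pq].
  have cl : closed (curves outer) [pred q | connect r (inl p) (inl q)].
    apply: intro_closed => [|p' q' /orP[]/eqP->].
    - by apply: curves_connect_sym => f; apply: state_pairingK.
    - rewrite !inE => pp; apply: connect_trans pp (connect1 _).
      exact: (curves_gap P (inl p')).
    rewrite !inE => pp; apply: connect_trans pp _.
    have [f c ->|np] := arrowP p'; last first.
      by rewrite glue_out // -glue_l_out //; apply/connect1/curves_glue.
    rewrite glue_end; apply: connect_trans (connect1 (curves_glue _ _)) _.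
    rewrite glue_l r_sym; apply: connect_trans (connect1 (curves_glue _ _)) _.
    rewrite glue_l r_sym; apply: connect_r.
    by rewrite open_curvesE /outer corner_map_state_pairing eqxx orbT.
  by move/(closed_connect cl); rewrite !inE connect0.
(* For the converse: the curve of [p] in G, with the arcs of the copies attached at its corners, is
   closed under [r]. *)
pose b : {pred pt (tensor e phi)} := [pred x | match x with
  | inl q => connect (curves outer) p q
  | inr (f, q) => [exists c, connect (curves outer) p (arrow_end (f, c)) &&
      connect (open_curves (S f)) (arrow_end (e, corner_map (phi f) c)) q]
  end].
have cl : closed r b.
  apply: intro_closed => // x y /orP[]/eqP-> {y};
    case: x => [q'|[f q']]; rewrite !inE.
  - by move=> pq'; apply: connect_trans pq' (connect1 (curves_gap _ _)).
  - move=> /existsP[c /andP[pc cq]]; apply/existsP; exists c; rewrite pc.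
    exact: connect_trans cq (connect1 (curves_gap _ _)).
  - have [f c ->|nq] := arrowP q'.
      move=> pc; rewrite glue_l; apply/existsP; exists c.
      by rewrite pc connect0.
    rewrite glue_l_out // -(glue_out outer nq) => pq'.
    exact: connect_trans pq' (connect1 (curves_glue _ _)).
  have [d ->|nq] := endP e q'.
    (* An arc leaves a copy at the end where it was entered or at its outer partner; both lead back
       to the curve of [p]. *)
    rewrite glue_r => /existsP[c /andP[pc]]; rewrite open_curvesE.
    case/orP=> /eqP->; first by rewrite permK.
    rewrite -corner_map_state_pairing permK.
    apply: connect_trans pc (connect1 _).
    by have := curves_glue outer (arrow_end (f, c)); rewrite glue_end.
  rewrite glue_r_out // => /existsP[c /andP[pc cq]]; apply/existsP; exists c.
  by rewrite pc; apply: connect_trans cq (connect1 (curves_glue _ _)).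
by have := closed_connect cl pq; rewrite !inE connect0.
Qed.

(** Curves meeting G or an open arc (the set [b]) correspond to curves of G in the outer states; all
    others are closed curves inside a single copy. *)
Lemma tensor_curves_count :
  n_comp r predT = (n_comp (curves outer) predT + \sum_f closed_curves (S f))%N.
Proof.
pose b : {pred pt (tensor e phi)} :=
  [pred x | if x is inr (f, q) then q \in meets_edge (S f) else true].
have inr_b f q : (inr (f, q) \in b) = (q \in meets_edge (S f)) by rewrite inE.
have no_edge f q : inr (f, q) \notin b -> forall c, arrow_end (e, c) != q.
  by rewrite inr_b => nq c; apply: contraNneq nq => <-; apply: meets_edge_end.
have cl_b : closed r b.
  apply: intro_closed => // x y /orP[]/eqP-> {y}; case: x => [p|[f q]] //.
  - by rewrite [gap _]/= !inr_b (closed_meets_edge (curves_gap _ q)).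
  - have [f c -> _|np _] := arrowP p; last by rewrite glue_l_out.
    by rewrite glue_l inr_b meets_edge_end.
  have [c ->|nq] := endP e q; first by rewrite glue_r.
  by rewrite glue_r_out // !inr_b (closed_meets_edge (curves_glue _ q)).
rewrite [LHS](n_compC b); congr (_ + _)%N.
  apply: (@adjunction_n_comp _ _ inl) => //.
    by apply: curves_connect_sym => f; apply: state_pairingK.
  (* Every point of an open arc is linked to G through an end of that arc. *)
  split=> [x|p q _]; last exact: connect_outer.
  case: x => [p _|[f q]]; first by exists p.
  rewrite inr_b => q_edge; apply: sigW; have /existsP[c cq] := q_edge.
  exists (arrow_end (f, (corner_map (phi f))^-1%g c)); rewrite r_sym.
  apply: connect_trans (connect1 (curves_glue _ _)) _.
  by rewrite glue_l permKV; apply: connect_r.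
pose B f : {pred pt (tensor e phi)} :=
  [pred x | if x is inr (g, q) then (g == f) && (q \notin meets_edge (S f))
            else false].
rewrite (@n_comp_sum _ _ _ _ B); last first.
  move=> [p|[f q]]; first by rewrite big1.
  rewrite (bigD1 f) //= big1 => [|g neq_gf]; first by rewrite !inE eqxx addn0.
  by rewrite !inE eq_sym (negPf neq_gf).
apply: eq_bigr => f _.
have inr_inj : injective (fun q => inr (f, q) : pt (tensor e phi)).
  by move=> q q' [].
have in_B q : (inr (f, q) \in B f) = (inr (f, q) \notin b) by rewrite !inE eqxx.
have sub_B x : x \in B f -> exists2 q, x = inr (f, q) & inr (f, q) \notin b.
  by case: x => [//|[g q]]; rewrite !inE => /andP[/eqP-> nq]; exists q.
rewrite (n_comp_closed_inj (h := fun q => inr (f, q))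
  (r' := open_curves (S f))) //.
- apply: eq_n_comp_r => q; by rewrite [LHS]inE in_B inr_b !inE.
- exact: open_curves_sym.
- apply: intro_closed => // x y xy /sub_B[q def_x nq].
  have : y \notin b by rewrite -(cl_b _ _ xy) def_x.
  move: xy; rewrite def_x => /orP[]/eqP->; first by rewrite [gap _]/= in_B.
  by rewrite glue_r_out ?in_B //; apply: no_edge nq.
- by apply/subsetP => x /sub_B[q -> _]; apply/codomP; exists q.
move=> q q'; rewrite in_B => nq; rewrite /r /curves /alternating.
by rewrite glue_r_out ?[gap (inr _)]/= ?(inj_eq inr_inj) //; apply: no_edge nq.
Qed.

End Tensor.

(** * Summation over states and the linear system *)

Lemma sum_vertex_state (C : nmodType) (F : vertex_state -> C) :
  \sum_x F x = F WhiteSmoothing + F BlackSmoothing + F Crossing.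
Proof.
rewrite (bigD1 WhiteSmoothing) // (bigD1 BlackSmoothing) // (bigD1 Crossing) //=.
by rewrite big1 ?addr0 ?addrA // => -[].
Qed.

(** A state of the tensor product is a family of states of the copies. Grouping the families by
    their outer states leaves a sum over the states of G. *)
Lemma transition_poly_tensor (C : comNzRingType) (G H : arrow_pres)
    (e : label H) (phi : label G -> identifying_map) (w : C * C * C) (t : C) :
  let k := outer_weight e w t in
  transition_poly (tensor e phi) w t
  = transition_poly G (k WhiteSmoothing, k BlackSmoothing, k Crossing) t.
Proof.
move=> k; pose state := {ffun other_label e -> vertex_state}.
pose weight (s : state) :=
  (\prod_h state_weight w (s h)) * t ^+ closed_curves s.
pose outers (S : {ffun label G -> state}) : graph_state (medial G) :=
  [ffun f => outer_state (S f)].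
pose uncurry (S : {ffun label G -> state}) :
    graph_state (medial (tensor e phi)) :=
  [ffun x => S x.1 x.2].
pose curry (S : graph_state (medial (tensor e phi))) :
    {ffun label G -> state} :=
  [ffun f => [ffun h => S (f, h)]].
have term (S : {ffun label G -> state}) :
    (\prod_v state_weight w (uncurry S v)) * t ^+ curve_count (uncurry S)
    = (\prod_f weight (S f)) * t ^+ curve_count (outers S).
  have -> : curve_count (uncurry S)
      = (curve_count (outers S) + \sum_f closed_curves (S f))%N.
    rewrite !curve_countE.
    have -> : n_comp (curves (fun f => state_pairing (outers S f))) predT
        = n_comp (curves (fun f => state_pairing (outer_state (S f)))) predT.
      apply/eq_n_comp/eq_connect => p q; congr (_ || (q == _)).
      by apply: eq_glue => f c; rewrite ffunE.
    rewrite -(tensor_curves_count phi S).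
    apply/eq_n_comp/eq_connect => p q; congr (_ || (q == _)).
    by apply: eq_glue => f c; rewrite ffunE.
  rewrite addnC exprD mulrA; congr (_ * _).
  rewrite big_split /= prodrXr pair_bigA /=; congr (_ * _).
  by apply: eq_bigr => x _; rewrite ffunE.
rewrite /transition_poly (reindex uncurry) /=; last first.
  exists curry => S _.
    by apply/ffunP => f; apply/ffunP => h; rewrite !ffunE.
  by apply/ffunP => -[f h]; rewrite !ffunE.
under eq_bigr do rewrite term.
rewrite (partition_big outers predT) //=; apply: eq_bigr => s _.
under eq_bigr => S /eqP-> do over.
rewrite -mulr_suml; congr (_ * _).
(* With the outer states prescribed, the copies are chosen independently, so the sum factors over
   the edges of G. *)
transitivity (\prod_f \sum_(s' : state | outer_state s' == s f) weight s').
  rewrite bigA_distr_big_dep; apply: eq_bigl => S.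
  apply/eqP/familyP => [<- f|outer_S]; first by rewrite ffunE unfold_in.
  by apply/ffunP => f; rewrite ffunE; apply/eqP/outer_S.
by apply: eq_bigr => f _; case: (s f).
Qed.

(** The three equations add up to [t * (t + 2) * (a + b + c) = 0]. Subtracting [t * (a + b + c) = 0]
    from each leaves [t * (t - 1)] times one unknown. *)
Lemma smoothing_system_trivial (F : fieldType) (t a b c : F) :
  t != 0 -> t != 1 -> t != - 2%:R ->
  t * a + t ^+ 2 * b + t * c = 0 -> t ^+ 2 * a + t * b + t * c = 0 ->
  t * a + t * b + t ^+ 2 * c = 0 -> [/\ a = 0, b = 0 & c = 0].
Proof.
move=> t0 t1 t2 eq_b eq_a eq_c.
have sum0 : a + b + c = 0.
  apply: (@mulfI _ (t * (t + 2%:R))); first by rewrite mulf_neq0 // addr_eq0.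
  by rewrite mulr0 -[RHS](addr0 0) -{1}eq_a -{1}[0]addr0 -{1}eq_b -{1}eq_c; ring.
have t_sub1 : t * (t - 1) != 0 by rewrite mulf_neq0 // subr_eq0.
split; apply: (mulfI t_sub1); rewrite mulr0.
- by rewrite -eq_a -[RHS]subr0 -(mulr0 t) -sum0; ring.
- by rewrite -eq_b -[RHS]subr0 -(mulr0 t) -sum0; ring.
- by rewrite -eq_c -[RHS]subr0 -(mulr0 t) -sum0; ring.
Qed.

Theorem theorem6p2 (R : realType) (G H : arrow_pres) (e : label H)
    (he : non_loop e) (phi : label G -> identifying_map)
    (alpha beta gamma t : R[i])
    (ht0 : t != 0) (ht1 : t != 1) (ht2 : t != - 2%:R) :
  let system (w : R[i] * R[i] * R[i]) :=
    let: (kappa, lambda, mu) := w in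
    [/\ t * kappa + t ^+ 2 * lambda + t * mu
          = transition_poly (delete e) (alpha, beta, gamma) t,
        t ^+ 2 * kappa + t * lambda + t * mu
          = transition_poly (contract e) (alpha, beta, gamma) t
      & t * kappa + t * lambda + t ^+ 2 * mu
          = transition_poly (contract (H := twist e) e) (alpha, beta, gamma) t] in
  exists kappa lambda mu : R[i],
    [/\ system (kappa, lambda, mu),
        forall w, system w -> w = (kappa, lambda, mu)
      & transition_poly (tensor e phi) (alpha, beta, gamma) t
          = transition_poly G (kappa, lambda, mu) t].
Proof.
move=> system; set w := (alpha, beta, gamma) in system *.
pose k := outer_weight e w t.
have k_system : system (k WhiteSmoothing, k BlackSmoothing, k Crossing).
  rewrite /system transition_poly_delete transition_poly_contract.
  by rewrite transition_poly_contract_twist !sum_vertex_state /= -/k; split; ring.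
exists (k WhiteSmoothing), (k BlackSmoothing), (k Crossing); split=> //.
  (* Uniqueness: the difference of two solutions solves the homogeneous system. *)
  move=> [[a b] c] [eq_b eq_a eq_c]; have [k_b k_a k_c] := k_system.
  have [] := @smoothing_system_trivial _ t (a - k WhiteSmoothing)
    (b - k BlackSmoothing) (c - k Crossing) ht0 ht1 ht2.
  - by rewrite -(subrr (transition_poly (delete e) w t)) -{1}eq_b -k_b; ring.
  - by rewrite -(subrr (transition_poly (contract e) w t)) -{1}eq_a -k_a; ring.
  - rewrite -(subrr (transition_poly (contract (H := twist e) e) w t)).
    by rewrite -{1}eq_c -k_c; ring.
  by do 3![move/subr0_eq->].
exact: transition_poly_tensor.
Qed.
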